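(* Let $m_j$ be a positive integer, $\widehat{\lambda}_j\in\mathbb{C}$, let $n_1,\dots,n_{s_j}$ be positive integers with $\sum_{\ell=1}^{s_j}n_\ell=p_j$, let $M_j:=\mathrm{diag}(N_{n_1},\dots,N_{n_{s_j}})\in\mathbb{R}^{p_j\times p_j}$, let $R_j\in\mathbb{R}^{p_j\times p_j}$ be entrywise nonnegative, let $r_{\mathrm r}:=[\max_i(R_j)_{i1},\dots,\max_i(R_j)_{ip_j}]$ be the row vector of column maxima of $R_j$, and let $n_{\max}:=\max_\ell n_\ell$. Define complex numbers $\beta_0^{(k)},\dots,\beta_{n_{\max}-1}^{(k)}$ for $k=0,\dots,m_j-1$ by $\beta_0^{(0)}:=\widehat{\lambda}_j$, $\beta_1^{(0)}:=1$, $\beta_\ell^{(0)}:=0$ for $\ell=2,\dots,n_{\max}-1$ (only indices $\le n_{\max}-1$ being present), and, for $k=0,\dots,m_j-2$, $$\beta_0^{(k+1)}:=(\widehat{\lambda}_j+k+1)\beta_0^{(k)},\qquad \beta_\ell^{(k+1)}:=(\widehat{\lambda}_j+k+1)\beta_\ell^{(k)}+\beta_{\ell-1}^{(k)},\quad \ell=1,\dots,n_{\max}-1.$$ For $\ell=1,\dots,s_j$ and $k=0,\dots,m_j-2$, let $R_j^{(\ell)}\in\mathbb{R}^{p_j\times n_\ell}$ be the submatrix of $R_j$ consisting of its columns $\sum_{i=1}^{\ell-1}n_i+1,\dots,\sum_{i=1}^{\ell}n_i$, and let $$r_{\mathrm c}^{(j,\ell)}:=\Bigl[\max_i(R_j^{(\ell)})_{1i},\dots,\max_i(R_j^{(\ell)})_{p_ji}\Bigr]^T\in\mathbb{R}^{p_j},$$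 $$w^{(k,\ell)}:=\Bigl[|\beta_0^{(k)}|,\ |\beta_0^{(k)}|+|\beta_1^{(k)}|,\ \dots,\ \sum_{i=0}^{n_\ell-1}|\beta_i^{(k)}|\Bigr]\in\mathbb{R}^{1\times n_\ell},$$ $$\mathsf{Q}_k:=\bigl[r_{\mathrm c}^{(j,1)}w^{(k,1)},\dots,r_{\mathrm c}^{(j,s_j)}w^{(k,s_j)}\bigr]\in\mathbb{R}^{p_j\times p_j}.$$ Let $C_k:=\sum_{i=0}^{n_{\max}-1}\beta_i^{(k)}M_j^i$ for $k=0,\dots,m_j-1$. Define nonnegative matrices $\mathsf{R}_0,\dots,\mathsf{R}_{m_j-1}\in\mathbb{R}^{p_j\times p_j}$ by $\mathsf{R}_0:=R_j$ and $$\mathsf{R}_{k+1}:=\mathsf{Q}_k+|\widehat{\lambda}_j+k+1|\,\mathsf{R}_k+M_j\mathsf{R}_k+\mathbf{1}_{p_j}r_{\mathrm r}\mathsf{R}_k,\qquad k=0,\dots,m_j-2.$$ Then $$\prod_{i=0}^{m_j-1}\langle(\widehat{\lambda}_j+i)I_{p_j}+M_j,R_j\rangle\subseteq\langle C_{m_j-1},\mathsf{R}_{m_j-1}\rangle.$$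
   Context: $N_k\in\mathbb{R}^{k\times k}$ is the matrix with ones on the first superdiagonal and zeros elsewhere ($N_1=0$), and $\mathrm{diag}(\cdot)$ denotes a block diagonal matrix. $\mathbf{1}_{p_j}\in\mathbb{R}^{p_j}$ is the column vector of all ones; $I_k$ is the $k\times k$ identity matrix; $|\cdot|$ of a matrix is the entrywise modulus and inequalities between real matrices are entrywise; $M_j^0=I_{p_j}$. For $C\in\mathbb{C}^{m\times n}$ and entrywise nonnegative $R\in\mathbb{R}^{m\times n}$, $\langle C,R\rangle:=\{M\in\mathbb{C}^{m\times n}:|M-C|\le R\}$ is the interval matrix with midpoint $C$ and radius $R$. Products of interval matrices are results of complex interval arithmetic: the product $\boldsymbol{A}\boldsymbol{B}$ of two interval matrices is an interval matrix containing all products $MN$ with $M\in\boldsymbol{A}$, $N\in\boldsymbol{B}$; the operation is inclusion isotonic ($\boldsymbol{A}\subseteq\boldsymbol{A}'$ and $\boldsymbol{B}\subseteq\boldsymbol{B}'$ imply $\boldsymbol{A}\boldsymbol{B}\subseteq\boldsymbol{A}'\boldsymbol{B}'$), and it satisfies $\langle A,R\rangle\langle B,S\rangle\subseteq\langle AB,\ |A|S+R|B|+RS\rangle$. A product of interval matrices over $i$ is evaluated successively, the factor with the larger index multiplying from the left: $\prod_{i=0}^{k+1}\boldsymbol{A}_i=\boldsymbol{A}_{k+1}\prod_{i=0}^{k}\boldsymbol{A}_i$. *)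

(* Defs.v *)
From HB Require Import structures.
From mathcomp Require Import all_boot all_order all_algebra.
From mathcomp Require Import classical_sets reals.
From mathcomp Require Import complex.
Set Implicit Arguments.
Unset Strict Implicit.
Unset Printing Implicit Defensive.
Import Order.TTheory GRing.Theory Num.Theory.
Local Open Scope classical_set_scope.
Local Open Scope ring_scope.

Section IntervalMatrix.
Variable R : realType.

Definition lemx m n (A B : 'M[R]_(m, n)) : Prop := forall i j, A i j <= B i j.

Definition nonneg_mx m n (A : 'M[R]_(m, n)) : Prop := lemx 0 A.

(* [normc] is the modulus R[i] -> R; the generic [`| _ |] on R[i] would take
   its values in R[i]. *)
Definition modulus (z : R[i]) : R := ComplexField.Normc.normc z.

Definition absmx m n (A : 'M[R[i]]_(m, n)) : 'M[R]_(m, n) := map_mx modulus A.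

Definition interval_mx m n (C : 'M[R[i]]_(m, n)) (r : 'M[R]_(m, n)) :
    set 'M[R[i]]_(m, n) :=
  [set M | lemx (absmx (M - C)) r].

Definition is_interval_mx m n (A : set 'M[R[i]]_(m, n)) : Prop :=
  exists C r, nonneg_mx r /\ A = interval_mx C r.

(* The product of a complex interval arithmetic is not the set of all products
   M *m N, which need not be an interval matrix: it is any operation on interval
   matrices satisfying the following. *)
Record interval_product m n q
    (mul : set 'M[R[i]]_(m, n) -> set 'M[R[i]]_(n, q) ->
           set 'M[R[i]]_(m, q)) : Prop := IntervalProduct {
  interval_product_closed : forall A B,
    is_interval_mx A -> is_interval_mx B -> is_interval_mx (mul A B);
  interval_product_enclosure : forall A B,
    is_interval_mx A -> is_interval_mx B ->
    forall M N, A M -> B N -> mul A B (M *m N);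
  interval_product_isotonic : forall A A' B B',
    is_interval_mx A -> is_interval_mx A' ->
    is_interval_mx B -> is_interval_mx B' ->
    A `<=` A' -> B `<=` B' -> mul A B `<=` mul A' B';
  interval_product_radius : forall A r B s,
    nonneg_mx r -> nonneg_mx s ->
    mul (interval_mx A r) (interval_mx B s) `<=`
    interval_mx (A *m B) (absmx A *m s + r *m absmx B + r *m s) }.

(* mul (A k) (mul (A k.-1) ( ... (mul (A 1) (A 0)))) *)
Fixpoint interval_prod p
    (mul : set 'M[R[i]]_p -> set 'M[R[i]]_p -> set 'M[R[i]]_p)
    (A : nat -> set 'M[R[i]]_p) (k : nat) : set 'M[R[i]]_p :=
  if k is k'.+1 then mul (A k) (interval_prod mul A k') else A 0%N.

End IntervalMatrix.

Section JordanBlock.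
Variables (R : realType) (lam : R[i]) (s : nat) (n : 'I_s -> nat).

Local Notation p := (\sum_(l < s) n l)%N.
Local Notation n_max := (\max_(l < s) n l)%N.

Definition superdiag_mx k : 'M[R]_k :=
  \matrix_(i < k, j < k) ((j == i.+1 :> nat)%:R).

Definition Mmx : 'M[R]_p := \mxdiag_(l < s) superdiag_mx (n l).

Definition MmxC : 'M[R[i]]_p := map_mx (real_complex R) Mmx.

(* beta k l is \beta_l^{(k)}.  It is total in k and l: the value at l only
   depends on the values at indices <= l, and only l < n_max is used below. *)
Fixpoint beta (k l : nat) : R[i] :=
  if k is k'.+1 then
    (lam + k'%:R + 1) * beta k' l + (if l is l'.+1 then beta k' l' else 0)
  else match l with 0 => lam | 1 => 1 | _ => 0 end.

Definition Cmx (k : nat) : 'M[R[i]]_p :=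
  \sum_(i < n_max) beta k i *: (MmxC ^+ i).

Definition w (k : nat) (l : 'I_s) : 'rV[R]_(n l) :=
  \row_(c < n l) \sum_(i < c.+1) modulus (beta k i).

(* The entries of r are nonnegative in every use, so taking 0 as the value of
   the empty maximum does not change the maxima below. *)
Variable r : 'M[R]_p.

Definition col_max : 'rV[R]_p := \row_j \big[Num.max/0]_i r i j.

Definition block_row_max (l : 'I_s) : 'cV[R]_p :=
  \col_a \big[Num.max/0]_(c < n l) submxrow r l a c.

Definition Qmx (k : nat) : 'M[R]_p :=
  \mxrow_(l < s) (block_row_max l *m w k l).

Fixpoint Rmx (k : nat) : 'M[R]_p :=
  if k is k'.+1 then
    Qmx k' + modulus (lam + k'%:R + 1) *: Rmx k' + Mmx *m Rmx k'
      + const_mx 1 *m col_max *m Rmx k'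
  else r.

End JordanBlock.

(* Main.v *)
Require Import Defs.
From HB Require Import structures.
From mathcomp Require Import all_boot all_order all_algebra.
From mathcomp Require Import classical_sets reals.
From mathcomp Require Import complex.
Set Implicit Arguments.
Unset Strict Implicit.
Unset Printing Implicit Defensive.
Import Order.TTheory GRing.Theory Num.Theory.
Local Open Scope classical_set_scope.
Local Open Scope ring_scope.

(** Write [A_i] for the midpoint [(lam + i) I + M] and argue by induction on the
    number of factors: if the interval product of the first [k + 1] factors
    lies in [<C_k, R_k>], then by
    isotonicity and the radius estimate of the interval product the interval
    product of the first [k + 2] lies in
    [<A_{k+1} C_k, |A_{k+1}| R_k + r |C_k| + r R_k>].  It remains to compute this
    midpoint and to bound this radius by [R_{k+1}].

    Midpoint.  [M] is block diagonal with nilpotent shifts as blocks, so a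
    combination [\sum_i b_i M^i] is block diagonal with upper triangular
    Toeplitz blocks carrying [b_d] on the [d]-th superdiagonal ([CmxE]).  On a
    block of size [n_l] the terms with [d >= n_l] vanish, and multiplying by
    [a I + M] changes the constants to [a b_d + b_{d-1}]
    ([mul_scalarD_shift_toeplitz]), which is the recursion of [beta]; hence
    [A_{k+1} C_k = C_{k+1}] ([CmxS]).

    Radius.  The triangle inequality gives [|A_{k+1}| <= |lam + k + 1| I + M],
    and bounding each entry of [r] by the maximum of its column gives
    [r R_k <= 1 r_r R_k].  For the remaining term, the entry of [r |C_k|] in row
    [a] and column [c] of block [l] is the sum of [r_{a,t} |beta_{c-t}|] over the
    columns [t <= c] of that block.  Bounding [r_{a,t}] by its maximum over the
    block leaves [\sum_{d <= c} |beta_d|], which is the corresponding entry of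
    [Q_k] ([lemx_mul_absmx_Cmx]). *)

(** * Nonnegative matrices, moduli and interval matrices *)

Section EntrywiseOrder.
Variable R : realType.

Lemma modulus_ge0 (z : R[i]) : 0 <= modulus z.
Proof. by case: z => a b; apply: sqrtr_ge0. Qed.

Lemma modulus0 : modulus (0 : R[i]) = 0.
Proof. exact: ComplexField.Normc.normc0. Qed.

Lemma modulus_real (x : R) : 0 <= x -> modulus (real_complex R x) = x.
Proof. by move=> x0; rewrite /modulus /= expr0n addr0 sqrtr_sqr ger0_norm. Qed.

Lemma modulusD (x y : R[i]) : modulus (x + y) <= modulus x + modulus y.
Proof. exact: le_normcD. Qed.

Variables (m n q : nat).
Implicit Types A B : 'M[R]_(m, n).

Lemma lemx_trans A B C : lemx A B -> lemx B C -> lemx A C.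
Proof. by move=> AB BC i j; apply: le_trans (AB i j) (BC i j). Qed.

Lemma lemxD A A' B B' : lemx A A' -> lemx B B' -> lemx (A + B) (A' + B').
Proof. by move=> AA BB i j; rewrite !mxE lerD. Qed.

Lemma nonneg_mxD A B : nonneg_mx A -> nonneg_mx B -> nonneg_mx (A + B).
Proof. by move=> A0 B0 i j; rewrite -[0 : 'M__]addr0; apply: lemxD. Qed.

Lemma nonneg_mxZ (a : R) A : 0 <= a -> nonneg_mx A -> nonneg_mx (a *: A).
Proof.
by move=> a0 A0 i j; have := A0 i j; rewrite !mxE => ?; apply: mulr_ge0.
Qed.

Lemma nonneg_mxM A (S : 'M[R]_(n, q)) :
  nonneg_mx A -> nonneg_mx S -> nonneg_mx (A *m S).
Proof.
move=> A0 S0 i j; rewrite !mxE; apply: sumr_ge0 => t _; apply: mulr_ge0.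
  by have := A0 i t; rewrite mxE.
by have := S0 t j; rewrite mxE.
Qed.

Lemma lemx_mul2r A B (S : 'M[R]_(n, q)) :
  nonneg_mx S -> lemx A B -> lemx (A *m S) (B *m S).
Proof.
move=> S0 AB i j; rewrite !mxE; apply: ler_sum => t _.
by apply: ler_wpM2r (AB i t); have := S0 t j; rewrite mxE.
Qed.

Lemma sub_interval_mx (C : 'M[R[i]]_(m, n)) A B :
  lemx A B -> interval_mx C A `<=` interval_mx C B.
Proof. by move=> AB M /= MA; apply: lemx_trans MA AB. Qed.

End EntrywiseOrder.

(** * Block diagonal and Toeplitz matrices *)

Section BlockDiagonal.
Variables (s : nat) (n : 'I_s -> nat).

Lemma map_mxdiag (U V : nmodType) (f : U -> V) (B : forall l, 'M[U]_(n l)) :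
  f 0 = 0 -> map_mx f (\mxdiag_l B l) = \mxdiag_l map_mx f (B l).
Proof.
move=> f0; rewrite /mxdiag.
transitivity (\mxblock_(l, l')
    map_mx f (if l == l' then conform_mx 0 (B l) else 0 : 'M_(n l, n l'))).
  by apply/matrixP => i j; rewrite !mxE.
apply: eq_mxblock => l l'; case: eqVneq => [e|_].
  by case: _ / e; rewrite !conform_mx_id.
by apply/matrixP => i j; rewrite !mxE.
Qed.

Lemma mul_mxdiag (K : pzRingType) (A B : forall l, 'M[K]_(n l)) :
  (\mxdiag_l A l) *m (\mxdiag_l B l) = \mxdiag_l (A l *m B l).
Proof.
rewrite {2}/mxdiag mul_mxdiag_mxblock; apply: eq_mxblock => l l'.
case: eqVneq => [e|_]; last by rewrite mulmx0.
by case: _ / e; rewrite !conform_mx_id.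
Qed.

Lemma mxdiagX (K : pzRingType) (A : forall l, 'M[K]_(n l)) e :
  (\mxdiag_l A l) ^+ e = \mxdiag_l (A l ^+ e).
Proof.
elim: e => [|e IH]; first exact: esym (mxdiagZ 1).
rewrite exprS IH; apply: etrans (mul_mxdiag _ _) _.
by apply: eq_mxdiag => l; rewrite exprS.
Qed.

Lemma scale_mxdiag (K : pzRingType) (a : K) (A : forall l, 'M[K]_(n l)) :
  a *: (\mxdiag_l A l) = \mxdiag_l (a *: A l).
Proof.
rewrite -mul_scalar_mx -mxdiagZ mul_mxdiag.
by apply: eq_mxdiag => l; rewrite mul_scalar_mx.
Qed.

End BlockDiagonal.

Section Toeplitz.
Variable K : pzRingType.

(** The upper triangular Toeplitz matrix of size [k] with the constant [b d]
    on its [d]-th superdiagonal. *)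
Definition toeplitz_mx k (b : nat -> K) : 'M[K]_k :=
  \matrix_(i, j) (if (i <= j)%N then b (j - i)%N else 0).

(** The matrix with ones on the [e]-th superdiagonal and zeros elsewhere. *)
Definition shift_mx k e : 'M[K]_k :=
  \matrix_(i, j) ((j == i + e :> nat)%N)%:R.

(** Multiplying by the shift moves the rows up by one; the last row, which has
    no successor in ['I_k], becomes zero. *)
Lemma mulmx_shift1 k (A : 'M[K]_k) (i j : 'I_k) :
  (shift_mx k 1 *m A) i j = if insub i.+1 is Some i' then A i' j else 0.
Proof.
rewrite mxE; case: insubP => [i' _ ei'|ni].
  rewrite (bigD1 i') //= !mxE ei' addn1 eqxx mul1r big1 ?addr0 // => t ti'.
  rewrite mxE addn1 -ei' (_ : (t == i' :> nat) = false) ?mul0r //.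
  exact: negbTE.
rewrite big1 // => t _; rewrite mxE addn1.
by case: eqVneq (ltn_ord t) => [->|_ _]; [rewrite (negPf ni)|rewrite mul0r].
Qed.

Lemma shift_mxX k e : shift_mx k 1 ^+ e = shift_mx k e.
Proof.
elim: e => [|e IH].
  by apply/matrixP => i j; rewrite expr0 !mxE addn0 eq_sym.
rewrite exprS IH; apply/matrixP => i j.
apply: etrans (mulmx_shift1 _ _ _) _; rewrite [RHS]mxE addnS -addSn.
case: insubP => [i' _ ei'|ni]; first by rewrite mxE ei'.
case: eqP => // ej; case/negP: ni.
by apply: leq_ltn_trans (ltn_ord j); rewrite ej leq_addr.
Qed.

(** The terms with [e >= k] vanish, so any range of summation that contains
    the indices below [k] gives the same matrix. *)
Lemma sum_shift_mx k N (b : nat -> K) :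
  (k <= N)%N -> \sum_(e < N) b e *: shift_mx k e = toeplitz_mx k b.
Proof.
move=> kN; apply/matrixP => i j; rewrite summxE mxE; case: leqP => ij.
  have dN : (j - i < N)%N.
    by apply: leq_ltn_trans (leq_subr _ _) (leq_trans (ltn_ord j) kN).
  rewrite (bigD1 (Ordinal dN)) //= !mxE subnKC // eqxx mulr1 big1 ?addr0 //.
  move=> e ne; rewrite !mxE; case: eqP => [ej|_]; last by rewrite mulr0.
  by case/eqP: ne; apply: val_inj; rewrite /= ej addKn.
rewrite big1 // => e _; rewrite !mxE.
case: eqP => [ej|_]; last by rewrite mulr0.
by move: ij; rewrite ej ltnNge leq_addr.
Qed.

(** Multiplication by [a%:M + shift_mx k 1] acts on the sequence of
    superdiagonal constants as multiplication by [a + X] acts on the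
    coefficients of a power series. *)
Lemma mul_scalarD_shift_toeplitz k (a : K) (b : nat -> K) :
  (a%:M + shift_mx k 1) *m toeplitz_mx k b =
  toeplitz_mx k (fun d => a * b d + if d is d'.+1 then b d' else 0).
Proof.
apply/matrixP => i j; rewrite mulmxDl mxE mul_scalar_mx mulmx_shift1 !mxE.
case: insubP => [i' _ ei'|ni].
  rewrite mxE ei'; case: ltngtP => ij; last by rewrite ij subnn.
    by rewrite -{3}(subnSK ij).
  by rewrite mulr0 addr0.
case: ltngtP => ij; last by rewrite ij subnn.
  by case/negP: ni; apply: leq_ltn_trans (ltn_ord j).
by rewrite mulr0 addr0.
Qed.

End Toeplitz.

(** * Midpoints *)

Section Jordan.
Variables (R : realType) (lam : R[i]) (s : nat) (n : 'I_s -> nat).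

Lemma MmxCE : MmxC R n = \mxdiag_l shift_mx R[i] (n l) 1.
Proof.
rewrite /MmxC /Mmx map_mxdiag ?rmorph0 //; apply: eq_mxdiag => l.
by apply/matrixP => i j; rewrite !mxE addn1 rmorph_nat.
Qed.

Lemma CmxE k : Cmx lam n k = \mxdiag_l toeplitz_mx (n l) (beta lam k).
Proof.
rewrite /Cmx MmxCE.
transitivity (\sum_(e < \max_(l < s) n l)
    \mxdiag_l (beta lam k e *: shift_mx R[i] (n l) e)).
  apply: eq_bigr => e _; rewrite mxdiagX scale_mxdiag.
  by apply: eq_mxdiag => l; rewrite shift_mxX.
rewrite -mxdiag_sum; apply: eq_mxdiag => l.
exact: sum_shift_mx (leq_bigmax l).
Qed.

Lemma Cmx0 : Cmx lam n 0 = lam%:M + MmxC R n.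
Proof.
rewrite CmxE MmxCE -mxdiagZ -mxdiagD; apply: eq_mxdiag => l.
apply/matrixP => i j; rewrite !mxE -val_eqE /= addn1.
case: ltngtP => ij; first last.
- by rewrite ij subnn ltn_eqF // addr0.
- by rewrite mulr0n add0r; case: eqP ij => // ->; rewrite ltnNge leqnSn.
rewrite mulr0n add0r -(subnSK ij) /=.
have -> : (j == i.+1 :> nat) = (j - i.+1 == 0)%N.
  by rewrite subn_eq0 eqn_leq ij andbT.
by case: (j - i.+1)%N.
Qed.

Lemma CmxS k :
  ((lam + k.+1%:R)%:M + MmxC R n) *m Cmx lam n k = Cmx lam n k.+1.
Proof.
rewrite !CmxE MmxCE -mxdiagZ -mxdiagD mul_mxdiag; apply: eq_mxdiag => l.
rewrite mul_scalarD_shift_toeplitz; apply/matrixP => i j; rewrite !mxE /=.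
by rewrite -addrA natr1.
Qed.

(** * Radii *)

Lemma nonneg_Mmx : nonneg_mx (Mmx R n).
Proof.
(* A block diagonal matrix is fixed by the entrywise absolute value as soon as
   its blocks are. *)
suff <- : map_mx Num.norm (Mmx R n) = Mmx R n by move=> i j; rewrite !mxE.
rewrite /Mmx map_mxdiag ?normr0 //; apply: eq_mxdiag => l.
by apply/matrixP => i j; rewrite !mxE normr_nat.
Qed.

Lemma absmx_scalarD_MmxC (a : R[i]) :
  lemx (absmx (a%:M + MmxC R n)) ((modulus a)%:M + Mmx R n).
Proof.
move=> i j; have := nonneg_Mmx i j; rewrite [_ i j]mxE => /modulus_real M0.
rewrite [leLHS]mxE [in leLHS]mxE [leRHS]mxE [X in _ + X]mxE -[in leRHS]M0.
apply: le_trans (modulusD _ _) _; rewrite lerD // !mxE.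
by case: (i == j); rewrite ?mulr1n ?mulr0n ?modulus0.
Qed.

Variable r : 'M[R]_(\sum_(l < s) n l).
Hypothesis hr : nonneg_mx r.

Lemma nonneg_block_row_max l : nonneg_mx (block_row_max r l).
Proof. by move=> i j; rewrite !mxE bigmax_ge_id. Qed.

Lemma nonneg_w k l : nonneg_mx (w lam n k l).
Proof. by move=> i j; rewrite !mxE sumr_ge0 // => *; apply: modulus_ge0. Qed.

Lemma nonneg_Qmx k : nonneg_mx (Qmx lam r k).
Proof.
move=> i j; rewrite [leRHS]mxE [leLHS]mxE.
have Q0 l := nonneg_mxM (@nonneg_block_row_max l) (@nonneg_w k l).
by have := Q0 _ i (tagnat.sig2 j); rewrite [_ i _]mxE.
Qed.

Lemma lemx_col_max : lemx r (const_mx 1 *m col_max r).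
Proof.
move=> i j; rewrite !mxE big_ord1 !mxE mul1r.
exact: (le_bigmax _ (fun i => r i j)).
Qed.

Lemma nonneg_Rmx k : nonneg_mx (Rmx lam r k).
Proof.
elim: k => //= k IH; do 3?[apply: nonneg_mxD].
- exact: nonneg_Qmx.
- exact: nonneg_mxZ (modulus_ge0 _) IH.
- exact: nonneg_mxM nonneg_Mmx IH.
by apply: nonneg_mxM IH; apply: lemx_trans hr lemx_col_max.
Qed.

Lemma lemx_mul_absmx_Cmx k : lemx (r *m absmx (Cmx lam n k)) (Qmx lam r k).
Proof.
rewrite CmxE /absmx map_mxdiag ?modulus0 // -[r in X in lemx X _]submxrowK.
rewrite mul_mxrow_mxdiag /Qmx => i j; rewrite [leLHS]mxE [leRHS]mxE.
move: (tagnat.sig1 j) (tagnat.sig2 j) => l c; rewrite !mxE big_ord1 !mxE.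
set rc := \big[Num.max/0]_(_ < _) _.
apply: (@le_trans _ _ (\sum_(t < n l) rc *
    modulus (if (t <= c)%N then beta lam k (c - t) else 0))).
  apply: ler_sum => t _; rewrite !mxE.
  apply: ler_wpM2r; first exact: modulus_ge0.
  by have := le_bigmax 0 (fun u => submxrow r l i u) t; rewrite mxE.
(* The Toeplitz column [c] sums exactly to the weight in [w]: its nonzero
   entries are those with [t <= c], reindexed here by [t |-> c - t]. *)
rewrite -mulr_sumr ler_wpM2l ?bigmax_ge_id // le_eqVlt; apply/orP; left.
under eq_bigr => t _ do rewrite (fun_if (@modulus R)) modulus0 -ltnS.
rewrite -big_mkcond /=.
rewrite -(big_ord_widen (n l) (fun t => modulus (beta lam k (c - t)))) //.
apply/eqP; rewrite (reindex_inj rev_ord_inj) /=.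
by apply: eq_bigr => t _; rewrite subSS subKn // -ltnS.
Qed.

(** The radius that the product estimate gives for the interval matrices
    [<A_{k+1}, r>] and [<C_k, R_k>] is at most [R_{k+1}]. *)
Lemma radius_le_RmxS k :
  lemx (absmx ((lam + k.+1%:R)%:M + MmxC R n) *m Rmx lam r k
        + r *m absmx (Cmx lam n k) + r *m Rmx lam r k) (Rmx lam r k.+1).
Proof.
have R0 := nonneg_Rmx k.
rewrite /= -(addrA (Qmx _ _ _)) (addrC (Qmx _ _ _)); apply: lemxD.
  apply: lemxD (lemx_mul_absmx_Cmx k).
  rewrite -addrA natr1 -mul_scalar_mx -mulmxDl.
  exact/lemx_mul2r/absmx_scalarD_MmxC.
exact: lemx_mul2r R0 lemx_col_max.
Qed.

End Jordan.
Theorem theorem5p4 (R : realType) (m : nat) (hm : (0 < m)%N) (lam : R[i])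
    (s : nat) (hs : (0 < s)%N)
    (n : 'I_s -> nat) (hn : forall l, (0 < n l)%N)
    (r : 'M[R]_(\sum_(l < s) n l)) (hr : nonneg_mx r)
    (mul : set 'M[R[i]]_(\sum_(l < s) n l) -> set 'M[R[i]]_(\sum_(l < s) n l) ->
           set 'M[R[i]]_(\sum_(l < s) n l))
    (hmul : interval_product mul) :
  interval_prod mul
    (fun i => interval_mx ((lam + i%:R)%:M + MmxC R n) r) m.-1
  `<=` interval_mx (Cmx lam n m.-1) (Rmx lam r m.-1).
Proof.
have hA i : is_interval_mx (interval_mx ((lam + i%:R)%:M + MmxC R n) r).
  by exists ((lam + i%:R)%:M + MmxC R n), r.
elim: (m.-1) => [|k IH] /=; first by rewrite addr0 Cmx0.
have hP : is_interval_mx (interval_prod mul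
    (fun i => interval_mx ((lam + i%:R)%:M + MmxC R n) r) k).
  by elim: (k) => //= k' IHk; apply: interval_product_closed.
have R0 := nonneg_Rmx lam hr k.
have step := interval_product_radius hmul
  (A := (lam + k.+1%:R)%:M + MmxC R n) (B := Cmx lam n k) hr R0.
rewrite CmxS in step.
move=> M kM; apply: (sub_interval_mx (radius_le_RmxS lam hr k)).
apply: step; move: M kM.
apply: (interval_product_isotonic hmul) => //.
by exists (Cmx lam n k), (Rmx lam r k).
Qed.
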